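(* Let $A$ be the Szmielew group $$A=\bigoplus_{p\ \text{prime}}\Bigl[\bigoplus_{n>0}\mathbb{Z}(p^n)^{(\kappa_{p,n-1})}\oplus\mathbb{Z}(p^\infty)^{(\lambda_p)}\oplus\mathbb{Z}_{(p)}^{(\mu_p)}\Bigr]\oplus\mathbb{Q}^{(\nu)},$$ where $\kappa_{p,n-1},\lambda_p,\mu_p,\nu$ are cardinals $\le\omega$. For a prime $p$ let $I_p=\{n>0:\kappa_{p,n-1}>0\}$, and if $I_p$ is finite and nonempty let $l_p$ be its maximal element. The following are equivalent: (1) $A$ is square-like; (2) for any prime $p$ one of the following holds: (i) $\lambda_p=\omega$; (ii) $\lambda_p=0$, and if $I_p$ is finite and nonempty then $\kappa_{p,\,l_p-1}=\omega$; (iii) $0<\lambda_p<\omega$, and $I_p$ is infinite.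
   Context: $B^{(\kappa)}$ denotes the direct sum of $\kappa$ copies of $B$; $\mathbb{Z}(n)$ is the cyclic group of order $n$; $\mathbb{Z}(p^\infty)$ is the Pr\''ufer $p$-group; $\mathbb{Z}_{(p)}$ is the additive group of rationals with denominator not divisible by $p$; $\mathbb{Q}$ is the additive group of rationals. A group $G$ is called square-like if $G$ and its direct square $G^2=G\times G$ are universally equivalent, i.e. satisfy the same universal first order sentences of the language of groups. *)

(* Defs.v *)
From HB Require Import structures.
From mathcomp Require Import all_boot all_order all_algebra.
From mathcomp Require Import boolp classical_sets functions cardinality.

Set Implicit Arguments.
Unset Strict Implicit.
Unset Printing Implicit Defensive.

Import Order.TTheory GRing.Theory Num.Theory.
Local Open Scope classical_set_scope.
Local Open Scope ring_scope.

Inductive group_term (n : nat) : Type :=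
  | TVar of 'I_n
  | TOne
  | TMul of group_term n & group_term n
  | TInv of group_term n.

Inductive qf_formula (n : nat) : Type :=
  | FEq of group_term n & group_term n
  | FNot of qf_formula n
  | FAnd of qf_formula n & qf_formula n
  | FOr of qf_formula n & qf_formula n
  | FImp of qf_formula n & qf_formula n.

Fixpoint eval_term (G : groupType) n (v : 'I_n -> G) (t : group_term n) : G :=
  match t with
  | TVar i => v i
  | TOne => 1%g
  | TMul s t => (eval_term v s * eval_term v t)%g
  | TInv s => (eval_term v s)^-1%g
  end.

Fixpoint holds (G : groupType) n (v : 'I_n -> G) (f : qf_formula n) : Prop :=
  match f with
  | FEq s t => eval_term v s = eval_term v t
  | FNot f => ~ holds v f
  | FAnd f g => holds v f /\ holds v g
  | FOr f g => holds v f \/ holds v g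
  | FImp f g => holds v f -> holds v g
  end.

(* The sentence [forall x_0 ... x_(n-1), f]: the matrix f is quantifier-free
   and, its variables being indexed by 'I_n, has no other free variable. *)
Record universal_sentence : Type := UniversalSentence {
  quantified_vars : nat;
  sentence_matrix : qf_formula quantified_vars
}.

Definition satisfies (G : groupType) (s : universal_sentence) : Prop :=
  forall v : 'I_(quantified_vars s) -> G, holds v (sentence_matrix s).

Definition universally_equivalent (G H : groupType) : Prop :=
  forall s : universal_sentence, satisfies G s <-> satisfies H s.

Definition square_like (G : groupType) : Prop :=
  universally_equivalent G (G * G)%type.

Section DirectSum.
Variables (I : Type) (B : I -> zmodType).

Definition full_product : Type := forall i, B i.

HB.instance Definition _ := Choice.copy full_product (forall i, B i).

Definition full_zero : full_product := fun _ => 0.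
Definition full_opp (f : full_product) : full_product := fun i => - f i.
Definition full_add (f g : full_product) : full_product := fun i => f i + g i.

Fact full_addA : associative full_add.
Proof. by move=> f g h; apply: functional_extensionality_dep => i; apply: addrA. Qed.
Fact full_addC : commutative full_add.
Proof. by move=> f g; apply: functional_extensionality_dep => i; apply: addrC. Qed.
Fact full_add0 : left_id full_zero full_add.
Proof. by move=> f; apply: functional_extensionality_dep => i; apply: add0r. Qed.
Fact full_addN : left_inverse full_zero full_opp full_add.
Proof. by move=> f; apply: functional_extensionality_dep => i; apply: addNr. Qed.

HB.instance Definition _ :=
  GRing.isZmodule.Build full_product full_addA full_addC full_add0 full_addN.

Definition finitely_supported : {pred full_product} :=
  fun f => `[< finite_set [set i | f i != 0] >].

Fact finitely_supported_zmod_closed : zmod_closed finitely_supported.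
Proof.
split=> [|f g /asboolP Ff /asboolP Fg]; apply/asboolP.
  rewrite (_ : mkset _ = set0); first exact: finite_set0.
  by apply/seteqP; split=> i //=; rewrite eqxx.
have Ffg : finite_set ([set i | f i != 0] `|` [set i | g i != 0]).
  by rewrite finite_setU.
apply: sub_finite_set Ffg => i /=.
have [fi0|] := eqVneq (f i) 0; last by left.
have [gi0|] := eqVneq (g i) 0; last by right.
suff -> : (f - g) i = 0 by rewrite eqxx.
by apply: (etrans (_ : _ = f i - g i)) => //; rewrite fi0 gi0 subr0.
Qed.

HB.instance Definition _ := GRing.isZmodClosed.Build full_product
  finitely_supported finitely_supported_zmod_closed.

Definition direct_sum : Type := {f : full_product | f \in finitely_supported}.

HB.instance Definition _ := SubChoice.on direct_sum.
HB.instance Definition _ := [SubChoice_isSubZmodule of direct_sum by <:].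

End DirectSum.

Inductive cardinal_le_omega : Type := Fin of nat | Omega.

Definition index_of (k : cardinal_le_omega) : Type :=
  match k with Fin n => 'I_n | Omega => nat end.

Definition copies (k : cardinal_le_omega) (B : zmodType) : zmodType :=
  direct_sum (fun _ : index_of k => B).

Definition prime_number : Type := {p : nat | prime p}.

Fact denq_dvd (x : rat) (d : int) :
  x * d%:~R \is a Num.int -> (`|denq x| %| `|d|)%N.
Proof.
move=> /intrP[n xd].
have : numq x * d = n * denq x.
  apply/eqP; rewrite -(eqr_int rat) !rmorphM /= -xd numqE.
  by rewrite mulrAC.
move=> /(congr1 absz); rewrite !abszM => e.
have : (`|denq x| %| `|numq x| * `|d|)%N by rewrite e dvdn_mull.
by rewrite Gauss_dvdr // coprime_sym coprime_num_den.
Qed.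

Fact denqB_dvd (x y : rat) : (`|denq (x - y)| %| `|denq x| * `|denq y|)%N.
Proof.
rewrite -abszM; apply: denq_dvd.
have -> : (x - y) * (denq x * denq y)%:~R
    = (numq x * denq y - numq y * denq x)%:~R.
  rewrite rmorphB /= !rmorphM /= !numqE mulrBl.
  by rewrite -!mulrA [(denq y)%:~R * _]mulrC.
exact: intr_int.
Qed.

Section SubgroupsOfRat.
Variable p : prime_number.

Definition has_ppower_denq : {pred rat} :=
  fun x => (val p).-nat `|denq x|%N.

Fact has_ppower_denq_zmod_closed : zmod_closed has_ppower_denq.
Proof.
split=> [|x y]; rewrite !unfold_in // => px py.
by apply: pnat_dvd (denqB_dvd x y) _; rewrite pnatM px.
Qed.

HB.instance Definition _ :=
  GRing.isZmodClosed.Build rat has_ppower_denq has_ppower_denq_zmod_closed.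

Definition Z_inv : Type := {x : rat | x \in has_ppower_denq}.

HB.instance Definition _ := SubChoice.on Z_inv.
HB.instance Definition _ := [SubChoice_isSubZmodule of Z_inv by <:].

Definition integers : {pred Z_inv} := fun x => val x \is a Num.int.

Fact integers_zmod_closed : zmod_closed integers.
Proof.
split=> [|x y]; rewrite !unfold_in // => px py.
by rewrite raddfB; apply: (rpredB px py).
Qed.

HB.instance Definition _ :=
  GRing.isZmodClosed.Build Z_inv integers integers_zmod_closed.

(* Z(p^oo) as Z[1/p] / Z. *)
Definition pruefer : zmodType := Quotient.quot integers.

Definition has_pprime_denq : {pred rat} :=
  fun x => ~~ (val p %| `|denq x|)%N.

Fact has_pprime_denq_zmod_closed : zmod_closed has_pprime_denq.
Proof.
split=> [|x y].
  by rewrite unfold_in /= dvdn1; case: p => -[|[]].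
rewrite !unfold_in => px py; apply/negP => pxy.
have := dvdn_trans pxy (denqB_dvd x y).
by rewrite Euclid_dvdM ?(valP p) // (negbTE px) (negbTE py).
Qed.

HB.instance Definition _ :=
  GRing.isZmodClosed.Build rat has_pprime_denq has_pprime_denq_zmod_closed.

Definition Z_loc : Type := {x : rat | x \in has_pprime_denq}.

HB.instance Definition _ := SubChoice.on Z_loc.
HB.instance Definition _ := [SubChoice_isSubZmodule of Z_loc by <:].

End SubgroupsOfRat.

Section Szmielew.
Variables (kappa : prime_number -> nat -> cardinal_le_omega).
Variables (lambda mu : prime_number -> cardinal_le_omega).
Variable nu : cardinal_le_omega.

(* The cyclic summands are indexed by m = n - 1, so that kappa p m is the
   multiplicity of Z(p^(m+1)). *)
Definition szmielew_component (p : prime_number) : zmodType :=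
  (direct_sum (fun m : nat => copies (kappa p m) 'Z_(val p ^ m.+1)) *
   copies (lambda p) (pruefer p) *
   copies (mu p) (Z_loc p))%type.

Definition szmielew_group : zmodType :=
  (direct_sum szmielew_component * copies nu rat)%type.

Definition cyclic_exponents (p : prime_number) : set nat :=
  [set n | (0 < n)%N /\ kappa p n.-1 <> Fin 0].

End Szmielew.

(* Main.v *)
Require Import Defs.
From HB Require Import structures.
From mathcomp Require Import all_boot all_order all_algebra.
From mathcomp Require Import boolp classical_sets functions cardinality.

(* Both conditions say that, for every finite system E of integral linear
   equations and every integral linear form t, the subgroup t(W) of A, where W
   is the group of solutions of E in A, is trivial or infinite.

   If all these subgroups are trivial or infinite, then any finite set of
   equations and inequations solvable in A x A is solvable in A: each form t in
   an inequation is non-zero on W, hence has a kernel of infinite index in W,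
   and by B.H. Neumann's lemma W is not the union of these kernels.

   For a Szmielew group, t(W) is a direct sum over the summands.  A summand
   that contributes is torsion-free, and then t(W) is infinite, or is Z(p^m) or
   Z(p^oo); in that case every Z(p^m') with m' >= m large, and Z(p^oo),
   contributes as well, and condition (2) provides infinitely many of these.

   Conversely, if condition (2) fails at p, then for some L the group
   { p^L x | p^(L+1) x = 0 } is finite and non-trivial, so that it has strictly
   fewer elements than its analogue in A x A, which a universal sentence
   detects. *)

Set Implicit Arguments.
Unset Strict Implicit.
Unset Printing Implicit Defensive.

Import Order.TTheory GRing.Theory Num.Theory.
Local Open Scope classical_set_scope.
Local Open Scope ring_scope.

(** * Group terms as integral linear forms; transfer of quantifier-free formulas *)

Section LinearForms.
Variable n : nat.
Implicit Types (A B : zmodType) (c : {ffun 'I_n -> int}).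

Definition lin A c (v : 'I_n -> A) : A := \sum_i v i *~ c i.

Lemma lin0l A (v : 'I_n -> A) : lin 0 v = 0.
Proof. by rewrite /lin big1 // => i _; rewrite ffunE mulr0z. Qed.

Lemma linDl A c d (v : 'I_n -> A) : lin (c + d) v = lin c v + lin d v.
Proof. by rewrite /lin -big_split; apply: eq_bigr => i _; rewrite ffunE mulrzDr. Qed.

Lemma linNl A c (v : 'I_n -> A) : lin (- c) v = - lin c v.
Proof. by rewrite /lin -sumrN; apply: eq_bigr => i _; rewrite ffunE mulrNz. Qed.

Lemma lin_delta A i (v : 'I_n -> A) : lin [ffun j => (j == i)%:R] v = v i.
Proof.
rewrite /lin (bigD1 i) //= ffunE eqxx mulr1z big1 ?addr0 // => j /negbTE ji.
by rewrite ffunE ji mulr0z.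
Qed.

Lemma linB A c (v w : 'I_n -> A) : lin c (v \- w) = lin c v - lin c w.
Proof. by rewrite /lin -sumrB; apply: eq_bigr => i _; rewrite mulrzBl. Qed.

Lemma linMz A c (v : 'I_n -> A) (z : int) : lin c (fun i => v i *~ z) = lin c v *~ z.
Proof. by rewrite /lin mulrz_suml; apply: eq_bigr => i _; rewrite mulrzAC. Qed.

Lemma lin_comp A B (f : {additive A -> B}) c (v : 'I_n -> A) :
  lin c (f \o v) = f (lin c v).
Proof. by rewrite /lin raddf_sum; apply: eq_bigr => i _; rewrite raddfMz. Qed.

Lemma lin_multiples A (g : A) c (a : 'I_n -> int) :
  lin c (fun i => g *~ a i) = g *~ lin c a.
Proof. by rewrite /lin mulrz_sumr; apply: eq_bigr => i _; rewrite -mulrzA mulrzz. Qed.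

Fixpoint form_of_term (s : group_term n) : {ffun 'I_n -> int} :=
  match s with
  | TVar i => [ffun j => (j == i)%:R]
  | TOne => 0
  | TMul s t => form_of_term s + form_of_term t
  | TInv s => - form_of_term s
  end.

Fixpoint atoms (f : qf_formula n) : seq {ffun 'I_n -> int} :=
  match f with
  | FEq s t => [:: form_of_term s - form_of_term t]
  | FNot f => atoms f
  | FAnd f g | FOr f g | FImp f g => atoms f ++ atoms g
  end.

Lemma eval_term_lin A (v : 'I_n -> Algebra.to_multiplicative A) s :
  eval_term v s = lin (form_of_term s) (v : 'I_n -> A).
Proof.
elim: s => [i||s IHs t IHt|s IHs] /=.
- by rewrite lin_delta.
- by rewrite lin0l.
- by rewrite linDl -IHs -IHt.
- by rewrite linNl -IHs.
Qed.

Lemma eval_term_fst (G H : groupType) (v : 'I_n -> (G * H)%type) s :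
  (eval_term v s).1 = eval_term (fst \o v) s.
Proof. by elim: s => //= [s <- t <-|s <-]. Qed.

Lemma eval_term_snd (G H : groupType) (v : 'I_n -> (G * H)%type) s :
  (eval_term v s).2 = eval_term (snd \o v) s.
Proof. by elim: s => //= [s <- t <-|s <-]. Qed.

Lemma eval_term_lin2 A
    (v : 'I_n -> (Algebra.to_multiplicative A * Algebra.to_multiplicative A)%type) s :
  eval_term v s = lin (form_of_term s) (v : 'I_n -> (A * A)%type).
Proof.
rewrite [LHS]surjective_pairing eval_term_fst eval_term_snd !eval_term_lin.
rewrite [RHS]surjective_pairing; congr pair.
  exact: (lin_comp (fst : {additive (A * A)%type -> A})).
exact: (lin_comp (snd : {additive (A * A)%type -> A})).
Qed.

(** A quantifier-free formula sees only which atoms vanish, so it is enough to solve in [A] the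
    equations and inequations that hold in the square. *)
Lemma holds_lin A
    (v : 'I_n -> (Algebra.to_multiplicative A * Algebra.to_multiplicative A)%type)
    (w : 'I_n -> Algebra.to_multiplicative A) (f : qf_formula n) :
  {in atoms f, forall c, lin c (v : 'I_n -> (A * A)%type) = 0
                     <-> lin c (w : 'I_n -> A) = 0} ->
  holds v f <-> holds w f.
Proof.
elim: f => [s t|f IHf|f IHf g IHg|f IHf g IHg|f IHf g IHg] /= vw.
- have := vw _ (mem_head _ _).
  rewrite !linDl !linNl 2!eval_term_lin2 2!eval_term_lin => H.
  by split=> /eqP; rewrite -subr_eq0 => /eqP/H/eqP; rewrite subr_eq0 => /eqP.
- by rewrite IHf.
all: have vwf: {in atoms f, forall c, lin c (v : 'I_n -> (A * A)%type) = 0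
                     <-> lin c (w : 'I_n -> A) = 0}
  by move=> c fc; apply: vw; rewrite mem_cat fc.
all: have vwg: {in atoms g, forall c, lin c (v : 'I_n -> (A * A)%type) = 0
                     <-> lin c (w : 'I_n -> A) = 0}
  by move=> c fc; apply: vw; rewrite mem_cat fc orbT.
all: by rewrite IHf // IHg.
Qed.

End LinearForms.

(** * Solutions of linear systems and B.H. Neumann's lemma *)

Section Systems.
Variable n : nat.
Implicit Types (A B : zmodType) (E : seq {ffun 'I_n -> int}) (t : {ffun 'I_n -> int}).

Definition solution A E (v : 'I_n -> A) := forall c, c \in E -> lin c v = 0.

Definition nonvanishing A E t := exists2 v : 'I_n -> A, solution E v & lin t v <> 0.

Definition infinite_range A E t :=
  forall F : seq A, exists2 v : 'I_n -> A, solution E v & lin t v \notin F.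

Lemma solutionB A E (v w : 'I_n -> A) :
  solution E v -> solution E w -> solution E (v \- w).
Proof. by move=> Ev Ew c cE; rewrite linB Ev // Ew // subr0. Qed.

Lemma solution_comp A B (f : {additive A -> B}) E (v : 'I_n -> A) :
  solution E v -> solution E (f \o v).
Proof. by move=> Ev c cE; rewrite lin_comp Ev // raddf0. Qed.

(* B.H. Neumann: an abelian group is not covered by finitely many cosets of
   subgroups of infinite index.  By induction on the number of subgroups: if
   some coset [w0 + ker t] is avoided, every other coset of [ker t] can be
   translated onto it, at the price of enlarging F for the remaining forms. *)
Lemma avoid_finite A E (ts : seq {ffun 'I_n -> int}) :
  {in ts, forall t, infinite_range A E t} ->
  forall F : seq A, exists2 v : 'I_n -> A,
    solution E v & {in ts, forall t, lin t v \notin F}.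
Proof.
elim: ts => [_ F|t ts IH infE F].
  exists (fun=> 0) => // c _; rewrite /lin big1 // => i _.
  by rewrite mul0rz.
have [w0 Ew0 tw0] := infE t (mem_head _ _) F.
(* [rep a] is a solution where t takes the value a. If there is none it is zero, which only enlarges
   [D]. *)
have /choice[rep repP] (a : A) : exists r, forall v : 'I_n -> A,
    solution E v -> lin t v = a -> solution E r /\ lin t r = a.
  have [[v [Ev tv]]|nv] := pselect (exists v : 'I_n -> A, solution E v /\ lin t v = a).
    by exists v.
  by exists (fun=> 0) => v Ev tv; case: nv; exists v.
(* Subtracting [rep a \- w0] moves the coset where t is a to the one where t is [lin t w0]; [D]
   lists the amounts by which the other forms then drop. *)
pose D := [seq lin s (rep a \- w0) | s <- ts, a <- F].
have infts : {in ts, forall t, infinite_range A E t}.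
  by move=> s sts; apply: infE; rewrite inE sts orbT.
have [w Ew wF] := IH infts (F ++ [seq a + d | a <- F, d <- D]).
have [tF|tF] := boolP (lin t w \in F); last first.
  exists w => // s; rewrite inE => /predU1P[-> //|/wF].
  by rewrite mem_cat => /norP[].
have [Erep trep] := repP _ _ Ew erefl.
exists (w \- (rep (lin t w) \- w0)); first by do 2!apply: solutionB => //.
move=> s; rewrite inE => /predU1P[->|sts].
  by rewrite !linB trep opprB addrCA subrr addr0.
have := wF _ sts; apply: contra => sF.
rewrite mem_cat; apply/orP; right; apply/allpairsP.
exists (lin s (w \- (rep (lin t w) \- w0)), lin s (rep (lin t w) \- w0)); split=> //=.
  by apply/allpairsP; exists (s, lin t w).
by rewrite linB subrK.
Qed.

End Systems.

Lemma square_like_of_infinite_range (A : zmodType) :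
  (forall n (E : seq {ffun 'I_n -> int}) t,
     nonvanishing A E t -> infinite_range A E t) ->
  square_like (Algebra.to_multiplicative A).
Proof.
move=> infA [n f]; split=> sat v /=; last first.
  (* [A] embeds in the square as the first factor, and universal sentences pass to subgroups. *)
  apply/(holds_lin (v := fun i => (v i, 0 : A)) _); last exact: sat.
  move=> c _; rewrite [lin c _]surjective_pairing.
  rewrite -(lin_comp (fst : {additive (A * A)%type -> A})).
  rewrite -(lin_comp (snd : {additive (A * A)%type -> A})).
  have -> : lin c (snd \o (fun i => (v i, 0 : A))) = 0 :> A.
    by rewrite /lin big1 // => i _; rewrite mul0rz.
  by split=> [[]|->].
pose v' := v : 'I_n -> (A * A)%type.
(* [E] consists of the atoms vanishing at the tuple of the square; a solution of [E] in [A] must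
   keep the other atoms non-zero. *)
pose E := [seq c <- atoms f | lin c v' == 0].
have EP (pi : {additive (A * A)%type -> A}) : solution E (pi \o v').
  by apply: solution_comp => c; rewrite mem_filter => /andP[/eqP].
have [|w Ew wF] := @avoid_finite n A E [seq c <- atoms f | lin c v' != 0] _ [:: 0].
  move=> t; rewrite mem_filter => /andP[/eqP tv _]; apply: infA.
  have [t1|t1] := eqVneq (lin t v').1 0.
    exists (snd \o v'); first exact: (EP snd).
    rewrite (lin_comp (snd : {additive (A * A)%type -> A})) => t2.
    by apply: tv; rewrite [LHS]surjective_pairing t1 t2.
  exists (fst \o v'); first exact: (EP fst).
  by rewrite (lin_comp (fst : {additive (A * A)%type -> A})); apply/eqP.
apply/(holds_lin (w := w) _); last exact: sat.
move=> c fc; split=> [/eqP cv|cw].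
  by apply: Ew; rewrite mem_filter cv.
apply/eqP; apply: contraT => cv.
have := wF c; rewrite mem_filter cv fc => /(_ isT).
by rewrite inE cw eqxx.
Qed.

(** * Universal sentences bounding the size of { x^b | x^a = 1 } *)

Section Packing.
Variables a b : nat.

Definition power_term n k (i : 'I_n) : group_term n := iter k (TMul (TVar i)) (TOne n).

Lemma eval_power_term (G : groupType) n (v : 'I_n -> G) k i :
  eval_term v (power_term k i) = (v i ^+ k)%g.
Proof. by elim: k => [|k IHk] /=; rewrite ?expg0 // IHk expgS. Qed.

Definition conjunction n (I : Type) (g : I -> qf_formula n) (s : seq I) :=
  foldr (fun i => FAnd (g i)) (FEq (TOne n) (TOne n)) s.

Lemma holds_conjunction (G : groupType) n (v : 'I_n -> G) (I : eqType)
    (g : I -> qf_formula n) (s : seq I) :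
  holds v (conjunction g s) <-> {in s, forall i, holds v (g i)}.
Proof.
elim: s => [|i s IHs] /=; first by split.
rewrite IHs; split=> [[gi gs] j|gs]; first by rewrite inE => /predU1P[->|/gs].
by split=> [|j js]; apply: gs; rewrite inE ?eqxx ?js ?orbT.
Qed.

(** This bounds the cardinality of { x^b | x^a = 1 } below by n, and its negation can be written as
    a universal sentence. *)
Definition packing (G : groupType) n :=
  exists2 v : 'I_n -> G, forall i, (v i ^+ a = 1)%g & injective (fun i => (v i ^+ b)%g).

Definition no_packing n : universal_sentence := UniversalSentence (FImp
  (conjunction (fun i => FEq (power_term a i) (TOne n)) (enum 'I_n))
  (FNot (conjunction
    (fun ij => FNot (FEq (power_term b ij.1) (power_term b ij.2)))
    [seq ij <- enum {: 'I_n * 'I_n} | ij.1 != ij.2]))).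

Lemma no_packingP (G : groupType) n : satisfies G (no_packing n) <-> ~ packing G n.
Proof.
split=> [sat [v va vb]|npack v].
  have /= := sat v; rewrite !holds_conjunction; apply.
    by move=> i _ /=; rewrite eval_power_term.
  move=> [i j]; rewrite mem_filter /= => /andP[/eqP ij _].
  by rewrite !eval_power_term => /vb.
rewrite /= !holds_conjunction => va vb; apply: npack; exists v => [i|i j /= vij].
  by rewrite -eval_power_term va // mem_enum.
apply/eqP; apply: contraT => ij; case: (vb (i, j)).
  by rewrite mem_filter ij mem_enum.
by rewrite /= !eval_power_term.
Qed.

(** The n elements go into the first factor and x into the second; the power (1, x^b) is new because
    x^b is not 1. *)
Lemma packingS (G : groupType) n (x : G) :
  (x ^+ a = 1)%g -> (x ^+ b)%g <> 1%g -> packing G n -> packing (G * G)%type n.+1.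
Proof.
have expg_pair k (y z : G) : ((y, z) ^+ k)%g = ((y ^+ k)%g, (z ^+ k)%g).
  by elim: k => [|k IHk]; rewrite ?expg0 // !expgS IHk.
move=> xa xb [v va vb].
exists (fun i => if unlift ord0 i is Some j then (v j, 1%g) else (1%g, x)) => [i|i j].
  by case: unliftP => [j _|_]; rewrite expg_pair ?va ?xa ?expg1n.
case: unliftP => [i' ->|->]; case: unliftP => [j' ->|->];
  rewrite !expg_pair ?expg1n //.
- by move=> [/vb ->].
- by move=> [_ /esym].
- by move=> [_ /xb].
Qed.

End Packing.

Lemma expg_to_multiplicative (A : zmodType) (x : A) k :
  ((x : Algebra.to_multiplicative A) ^+ k)%g = x *+ k.
Proof. by elim: k => [|k IHk]; rewrite ?expg0 // expgS mulrS IHk. Qed.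

(* Otherwise the image under [x |-> b x] of the a-torsion would be finite and
   non-trivial, hence strictly smaller than its analogue in A * A. *)
Lemma square_like_torsion (A : zmodType) (a b : nat) (T : finType) (f : A -> T) :
    square_like (Algebra.to_multiplicative A) ->
    (forall x y, x *+ a = 0 -> y *+ a = 0 -> f x = f y -> x *+ b = y *+ b) ->
  forall x : A, x *+ a = 0 -> x *+ b = 0.
Proof.
move=> sqA f_inj x xa; apply: contrapT => xb.
(* A packing of size n in [A] gives one of size n+1 in the square, which square-likeness brings back
   to [A]. Large n then contradicts the finiteness of [T]. *)
have packA n : packing a b (Algebra.to_multiplicative A) n.
  elim: n => [|n IHn]; first by exists (fun=> 0) => [[]|[]].
  apply: contrapT => /no_packingP/sqA/no_packingP; apply.
  by apply: packingS (x : Algebra.to_multiplicative A) _ _ IHn;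
    rewrite expg_to_multiplicative.
have [v va vb] := packA #|T|.+1.
suff /leq_card : injective (f \o v) by rewrite card_ord ltnn.
move=> i j fij; apply: vb; rewrite !expg_to_multiplicative.
by apply: f_inj => //; rewrite -expg_to_multiplicative va.
Qed.

(** * Coordinates and inclusions of a direct sum *)

Section DirectSumMaps.
Variables (I : Type) (B : I -> zmodType).

Definition coordinate (i : I) (x : direct_sum B) : B i := val x i.

Fact coordinate_is_zmod_morphism i : zmod_morphism (coordinate i).
Proof. by move=> x y; rewrite /coordinate raddfB. Qed.

HB.instance Definition _ i :=
  GRing.isZmodMorphism.Build (direct_sum B) (B i) (coordinate i)
    (coordinate_is_zmod_morphism i).

Lemma coordinate_inj (x y : direct_sum B) :
  (forall i, coordinate i x = coordinate i y) -> x = y.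
Proof. by move=> xy; apply/val_inj/functional_extensionality_dep. Qed.

(** Equality in the arbitrary index type is decided classically, and b is transported along it. *)
Definition summand_fun (i : I) (b : B i) : full_product B :=
  fun j => if pselect (i = j) is left e then ecast j (B j) e b else 0.

Fact summand_fun_finite i (b : B i) : summand_fun b \in @finitely_supported I B.
Proof.
apply/asboolP; apply: sub_finite_set (finite_set1 i) => j /=.
by rewrite /summand_fun; case: pselect => [e _|_ /eqP].
Qed.

Definition summand (i : I) (b : B i) : direct_sum B :=
  exist _ (summand_fun b) (summand_fun_finite b).

Lemma coordinate_summand i (b : B i) : coordinate i (summand b) = b.
Proof.
rewrite /coordinate /= /summand_fun; case: pselect => // e.
by rewrite (Prop_irrelevance e erefl).
Qed.

Lemma coordinate_summand_neq i j (b : B i) : i <> j -> coordinate j (summand b) = 0.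
Proof. by move=> ij; rewrite /coordinate /= /summand_fun; case: pselect. Qed.

Fact summand_is_zmod_morphism i : zmod_morphism (@summand i).
Proof.
move=> x y; apply: coordinate_inj => j; rewrite raddfB /=.
have [<-|ij] := pselect (i = j); first by rewrite !coordinate_summand.
by rewrite !(coordinate_summand_neq _ ij) subr0.
Qed.

HB.instance Definition _ i :=
  GRing.isZmodMorphism.Build (B i) (direct_sum B) (@summand i)
    (@summand_is_zmod_morphism i).

Lemma summand_inj i : injective (@summand i).
Proof. by move=> x y xy; rewrite -(coordinate_summand x) xy coordinate_summand. Qed.

End DirectSumMaps.

(** * Sources of infinite ranges: injections, torsion-free groups, direct sums *)

Definition unbounded (X : eqType) (P : X -> Prop) :=
  forall s : seq X, exists2 x, P x & x \notin s.

Lemma unbounded_nat (P : nat -> Prop) :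
  (forall m, exists2 k, P k & (m <= k)%N) -> unbounded P.
Proof.
move=> unbP s; have [k Pk sk] := unbP (\max_(i <- s) i).+1.
exists k => //; apply/negP => ks; have : (k <= \max_(i <- s) i)%N by apply: leq_bigmax_seq.
by rewrite leqNgt sk.
Qed.

(** Each entry of F has at most one preimage satisfying P, so only a finite list has to be
    avoided. *)
Lemma unbounded_avoid (X : eqType) (P : X -> Prop) (Y : eqType) (g : X -> Y) :
    unbounded P -> (forall x x', P x -> P x' -> g x = g x' -> x = x') ->
  forall F : seq Y, exists2 x, P x & g x \notin F.
Proof.
move=> unbP g_inj F.
suff [s sP] : exists s : seq X, forall x, P x -> g x \in F -> x \in s.
  have [x Px xs] := unbP s; exists x => //.
  by apply: contra xs => /(sP _ Px).
elim: F => [|y F [s sP]]; first by exists [::].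
have [[z [Pz gz]]|nz] := pselect (exists z, P z /\ g z = y).
  exists (z :: s) => x Px; rewrite !inE => /predU1P[gx|/sP->//]; last by rewrite orbT.
  by rewrite (g_inj x z) ?eqxx // gx.
by exists s => x Px; rewrite inE => /predU1P[gx|/sP->//]; case: nz; exists x.
Qed.

Section Permanence.
Variables (n : nat) (E : seq {ffun 'I_n -> int}) (t : {ffun 'I_n -> int}).
Local Notation nonvanishing A := (nonvanishing A E t).
Local Notation infinite_range A := (infinite_range A E t).

Lemma infinite_range_inj (A B : zmodType) (f : {additive A -> B}) :
  injective f -> infinite_range A -> infinite_range B.
Proof.
move=> f_inj infA F.
have [s sP] : exists s : seq A, forall x, f x \in F -> x \in s.
  elim: F => [|y F [s sP]]; first by exists [::].
  have [[z fz]|nz] := pselect (exists z, f z = y).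
    exists (z :: s) => x; rewrite !inE -fz => /predU1P[/f_inj->|/sP->].
      by rewrite eqxx.
    by rewrite orbT.
  by exists s => x; rewrite inE => /predU1P[fx|/sP//]; case: nz; exists x.
have [v Ev tv] := infA s; exists (f \o v); first exact: solution_comp.
by rewrite lin_comp; apply: contra tv => /sP.
Qed.

(** The multiples of one non-zero value of t are pairwise distinct, and are again values of t at
    solutions. *)
Lemma infinite_range_torsionfree (A : zmodType) :
  (forall (x : A) k, x *+ k.+1 = 0 -> x = 0) -> nonvanishing A -> infinite_range A.
Proof.
move=> tfA [v Ev tv] F.
have [|i j _ _ ij|k _ kF] := @unbounded_avoid nat (fun=> True) A (fun k => lin t v *+ k) _ _ F.
- by apply: unbounded_nat => m; exists m.
- wlog lt_ij : i j ij / (i < j)%N.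
    by case: (ltngtP i j) => // lt_ij wlog_ij; [|apply/esym]; apply: wlog_ij.
  case: tv; apply: (tfA _ (j - i).-1).
  by rewrite prednK ?subn_gt0 // mulrnBr ?ij ?subrr // ltnW.
exists (fun i => v i *~ k); last by rewrite linMz -pmulrn.
by move=> c cE; rewrite linMz Ev // mul0rz.
Qed.

Lemma nonvanishing_pair (A B : zmodType) :
  nonvanishing (A * B)%type -> nonvanishing A \/ nonvanishing B.
Proof.
move=> [v Ev tv].
have [t1|t1] := eqVneq (lin t v).1 0; last first.
  left; exists (fst \o v); first exact: (solution_comp fst).
  by rewrite (lin_comp (fst : {additive (A * B)%type -> A})); apply/eqP.
right; exists (snd \o v); first exact: (solution_comp snd).
rewrite (lin_comp (snd : {additive (A * B)%type -> B})) => t2.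
by apply: tv; rewrite [LHS]surjective_pairing t1 t2.
Qed.

Lemma infinite_range_pairl (A B : zmodType) :
  infinite_range A -> infinite_range (A * B)%type.
Proof.
have inl_additive : zmod_morphism (fun a : A => (a, 0 : B)).
  by move=> x y; congr pair; rewrite subr0.
pose inl := HB.pack_for {additive A -> (A * B)%type} (fun a : A => (a, 0 : B))
  (GRing.isZmodMorphism.Build A (A * B)%type _ inl_additive).
by apply: (@infinite_range_inj _ _ inl) => x y [].
Qed.

Lemma infinite_range_pairr (A B : zmodType) :
  infinite_range B -> infinite_range (A * B)%type.
Proof.
have inr_additive : zmod_morphism (fun b : B => (0 : A, b)).
  by move=> x y; congr pair; rewrite subr0.
pose inr := HB.pack_for {additive B -> (A * B)%type} (fun b : B => (0 : A, b))
  (GRing.isZmodMorphism.Build B (A * B)%type _ inr_additive).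
by apply: (@infinite_range_inj _ _ inr) => x y [].
Qed.

Lemma nonvanishing_direct_sum (I : Type) (B : I -> zmodType) :
  nonvanishing (direct_sum B) -> exists i, nonvanishing (B i).
Proof.
move=> [v Ev tv]; apply: contrapT => nB; apply: tv.
apply: coordinate_inj => i; rewrite raddf0; apply: contrapT => tvi.
apply: nB; exists i; exists (coordinate i \o v); first exact: solution_comp.
by rewrite lin_comp.
Qed.

Lemma infinite_range_summand (I : Type) (B : I -> zmodType) i :
  infinite_range (B i) -> infinite_range (direct_sum B).
Proof. by apply: (infinite_range_inj (f := @summand _ B i)); apply: summand_inj. Qed.

(** Non-zero values of t from different summands stay distinct in the direct sum, so one value per
    contributing summand suffices. *)
Lemma infinite_range_direct_sum (I : eqType) (B : I -> zmodType) :
  unbounded (fun i => nonvanishing (B i)) -> infinite_range (direct_sum B).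
Proof.
move=> unbB F.
have solB (i : I) : {v : 'I_n -> B i |
    nonvanishing (B i) -> solution E v /\ lin t v <> 0}.
  apply: cid; have [[v Ev tv]|nB] := pselect (nonvanishing (B i)); first by exists v.
  by exists (fun=> 0).
pose v i := sval (solB i); have vP i := svalP (solB i) : _ -> solution E (v i) /\ _.
have [i j /vP[_ ti] _ ij|i /vP[Ei _] iF] :=
    unbounded_avoid (g := fun i => summand (lin t (v i))) unbB _ F.
  apply: contrapT => neq_ij; apply: ti.
  by rewrite -(coordinate_summand (lin t (v i))) ij coordinate_summand_neq // => /esym.
exists (@summand _ B i \o v i); first exact: solution_comp.
by rewrite lin_comp.
Qed.

End Permanence.

(** * Cyclic groups and divisibility of exponents *)

Definition has_order (B : zmodType) (g : B) (N : nat) :=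
  forall z : int, g *~ z = 0 <-> (N %| z)%Z.

Lemma has_order_mulrn (B : zmodType) (g : B) N k :
  has_order g N -> g *+ k = 0 <-> (N %| k)%N.
Proof. by move=> ordg; rewrite pmulrn; apply: ordg. Qed.

Section CyclicGroups.
Variables (n : nat) (E : seq {ffun 'I_n -> int}) (t : {ffun 'I_n -> int}).

(* For a group with a generator of order N this is [nonvanishing], read off on
   exponents. *)
Definition nonvanishing_mod (N : nat) := exists2 a : 'I_n -> int,
  forall c, c \in E -> (N %| lin c a)%Z & ~~ (N %| lin t a)%Z.

(** Multiplication by M / N embeds the cyclic group of order N in that of order M. Hence a
    contributing Z(p^m) makes every larger Z(p^m') contribute. *)
Lemma nonvanishing_mod_dvd N M :
  (0 < M)%N -> (N %| M)%N -> nonvanishing_mod N -> nonvanishing_mod M.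
Proof.
move=> M_gt0 /dvdnP[k defM] [a Ea ta].
have k_neq0 : k%:Z != 0 by case: k defM M_gt0 => // ->.
exists (fun i => a i *~ k) => [c cE|]; rewrite linMz mulrzz defM mulnC PoszM.
  by rewrite dvdz_mul2r // Ea.
by rewrite dvdz_mul2r.
Qed.

Lemma nonvanishing_of_mod (B : zmodType) (g : B) N :
  has_order g N -> nonvanishing_mod N -> nonvanishing B E t.
Proof.
move=> ordg [a Ea ta]; exists (fun i => g *~ a i) => [c cE|]; rewrite lin_multiples.
  exact/ordg/Ea.
by move/ordg; apply/negP.
Qed.

Lemma nonvanishing_mod_of (B : zmodType) (g : B) N (a : 'I_n -> int) :
    has_order g N -> solution E (fun i => g *~ a i) ->
  lin t (fun i => g *~ a i) <> 0 -> nonvanishing_mod N.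
Proof.
move=> ordg Ea ta; exists a => [c cE|].
  by apply/ordg; rewrite -lin_multiples Ea.
by apply/negP => /ordg; rewrite -lin_multiples.
Qed.

End CyclicGroups.

Section ZmodGenerator.
Variable N : nat.
Hypothesis N_gt1 : (1 < N)%N.

Lemma Zp_generator_order : has_order (1 : 'Z_N) N.
Proof.
move=> z; have -> : (N %| z)%Z = (N %| `|z|)%N by [].
have Zp_nat0 k : (k%:R == 0 :> 'Z_N) = (N %| k)%N.
  by rewrite -(inj_eq val_inj) /= val_Zp_nat.
case: (intP z) => [|k|k]; first by rewrite dvdn0.
  by rewrite -Zp_nat0; split=> /eqP.
rewrite abszN mulrNz -[`|_|%N]/k.+1 -Zp_nat0 -oppr_eq0; split=> /eqP //.
Qed.

Lemma Zp_mulrn_id (x : 'Z_N) : x *+ N = 0.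
Proof. by rewrite -mulr_natr pchar_Zp // mulr0. Qed.

Lemma Zp_generated (x : 'Z_N) : x = 1 *~ (x : nat).
Proof. by rewrite -[LHS]natr_Zp. Qed.

End ZmodGenerator.

(** * The Pruefer group as a union of cyclic groups *)

Section Pruefer.
Variable p : prime_number.
Let pr_p : prime (val p) := valP p.
Let q m : nat := (val p ^ m)%N.

Let q_gt0 m : (0 < q m)%N.
Proof. by rewrite expn_gt0 prime_gt0. Qed.

Let q_neq0 m : (q m)%:~R != 0 :> rat.
Proof. by rewrite intr_eq0 -lt0n. Qed.

Fact inverse_ppower_denq m : ((q m)%:~R^-1 : rat) \in has_ppower_denq p.
Proof. by rewrite unfold_in denqVz -?lt0n // pnatX pnat_id. Qed.

Definition inverse_ppower m : Z_inv p :=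
  exist (fun x => x \in has_ppower_denq p) _ (inverse_ppower_denq m).

Definition pruefer_class (x : Z_inv p) : pruefer p :=
  (\pi_(Quotient.quot (@integers p)))%qT x.

Fact pruefer_class_is_zmod_morphism : zmod_morphism pruefer_class.
Proof. by move=> x y; rewrite /pruefer_class raddfB. Qed.

HB.instance Definition _ := GRing.isZmodMorphism.Build (Z_inv p) (pruefer p)
  pruefer_class pruefer_class_is_zmod_morphism.

Lemma pruefer_class_surj (x : pruefer p) : exists y, x = pruefer_class y.
Proof. by exists (repr x); rewrite /pruefer_class reprK. Qed.

Lemma pruefer_class0 (x : Z_inv p) : pruefer_class x = 0 <-> val x \is a Num.int.
Proof.
have -> : (val x \is a Num.int) = (x - 0 \in @integers p) by rewrite subr0.
rewrite Quotient.idealrBE -[0 in X in X <-> _](raddf0 pruefer_class).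
by split=> /eqP.
Qed.

Definition pruefer_generator m : pruefer p := pruefer_class (inverse_ppower m).

Lemma pruefer_generator_order m : has_order (pruefer_generator m) (q m).
Proof.
move=> z; rewrite /pruefer_generator -raddfMz pruefer_class0 raddfMz /= -mulrzl.
split=> [/intrP[k]|/dvdzP[k ->]].
  move/(canRL (mulfVK (q_neq0 m))) => zk; apply/dvdzP; exists k.
  by apply: (@intr_inj rat); rewrite zk rmorphM.
by rewrite rmorphM /= mulfK // intr_int.
Qed.

Lemma pruefer_generatorD m k : pruefer_generator (m + k) *~ q k = pruefer_generator m.
Proof.
rewrite /pruefer_generator -raddfMz; congr pruefer_class; apply: val_inj.
rewrite raddfMz /= -mulrzl /q expnD PoszM rmorphM /= invfM mulrCA divff ?mulr1 //.
Qed.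

(** A representative with denominator p^m can be written over p^(m+k) for every k; this freedom
    gives finitely many elements a common denominator. *)
Lemma pruefer_generated (x : pruefer p) :
  exists m, forall k, exists z : int, x = pruefer_generator (m + k) *~ z.
Proof.
have [r ->] := pruefer_class_surj x.
have /p_natP[m denr] : (val p).-nat `|denq (val r)|%N := valP r.
exists m => k; exists ((q k)%:Z * numq (val r)).
rewrite mulrzA pruefer_generatorD /pruefer_generator -raddfMz; congr pruefer_class.
apply: val_inj; rewrite raddfMz /= -mulrzl -[LHS]divq_num_den /q -denr.
by rewrite absz_denq.
Qed.

Lemma pruefer_tuple_generated n (v : 'I_n -> pruefer p) :
  exists m, forall i, exists z : int, v i = pruefer_generator m *~ z.
Proof.
have /choice[m mP] i := pruefer_generated (v i).
exists (\max_i m i) => i; have [z] := mP i (\max_i m i - m i)%N.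
by rewrite subnKC ?leq_bigmax //; exists z.
Qed.

(** Once x is written over p^(m0+m), the hypothesis forces p^m0 to divide the numerator. So x is a
    multiple of the class of 1/p^m, with coefficient reduced modulo p^m. *)
Lemma pruefer_torsion m (x : pruefer p) : x *+ q m = 0 ->
  exists2 k, (k < q m)%N & x = pruefer_generator m *+ k.
Proof.
have [m0 /(_ m)[z ->]] := pruefer_generated x.
rewrite pmulrn -mulrzA => /pruefer_generator_order.
rewrite /q expnD PoszM dvdz_mul2r -?lt0n ?expn_gt0 ?prime_gt0 // => /dvdzP[y ->].
rewrite mulrC mulrzA addnC pruefer_generatorD.
have qm_gt0 : 0 < (q m)%:Z by rewrite ltz_nat.
have absz_mod : `|(y %% q m)%Z|%N = (y %% q m)%Z :> int.
  by rewrite gez0_abs // modz_ge0 // gt_eqF.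
exists `|(y %% q m)%Z|%N; first by rewrite -ltz_nat absz_mod ltz_pmod.
rewrite pmulrn absz_mod; apply/eqP; rewrite -subr_eq0 -mulrzBr.
apply/eqP/pruefer_generator_order; rewrite {1}(divz_eq y (q m)) addrK.
exact: dvdz_mull.
Qed.

End Pruefer.

(** * Direct sums of copies of one group *)

Section Copies.
Implicit Types (k : cardinal_le_omega) (B : zmodType).

Lemma index_of_inhabited k : k <> Fin 0 -> inhabited (index_of k).
Proof. by case: k => [[|m]|] // _; constructor; [apply: ord0|apply: 0%N]. Qed.

Lemma index_of_neq0 k : index_of k -> k <> Fin 0.
Proof. by move=> i k0; rewrite k0 in i; case: i. Qed.

Definition copy k B (i : index_of k) (b : B) : copies k B :=
  summand (B := fun=> B) (i := i) b.

Lemma coordinate_copy k B (i : index_of k) (b : B) : coordinate i (copy i b) = b.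
Proof. exact: coordinate_summand. Qed.

Lemma copy_mulrn k B (i : index_of k) (b : B) m : copy i b *+ m = copy i (b *+ m).
Proof. by rewrite /copy raddfMn. Qed.

Lemma copy0 k B (i : index_of k) : copy i (0 : B) = 0.
Proof. exact: raddf0. Qed.

(** Finitely many coordinates, each with finitely many codes, give finitely many codes in all. This
    supplies the finite-valued maps for [square_like_torsion]. *)
Lemma copies_finite_code k m B (C : finType) (c : B -> C) : k = Fin m ->
  exists (T : finType) (f : copies k B -> T), forall x y, f x = f y ->
    forall i, c (coordinate i x) = c (coordinate i y).
Proof.
move=> ->; exists {ffun 'I_m -> C}, (fun x => [ffun i => c (coordinate i x)]).
by move=> x y /ffunP xy i; have := xy i; rewrite !ffunE.
Qed.

Section NonVanishingCopies.
Variables (n : nat) (E : seq {ffun 'I_n -> int}) (t : {ffun 'I_n -> int}).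

Lemma nonvanishing_copies k B :
  nonvanishing (copies k B) E t <-> k <> Fin 0 /\ nonvanishing B E t.
Proof.
split=> [/nonvanishing_direct_sum[i nvB]|[/index_of_inhabited[i] [v Ev tv]]].
  by split=> //; apply: index_of_neq0.
exists (@summand _ (fun=> B) i \o v); first exact: solution_comp.
by rewrite lin_comp => t0; apply: tv; apply: (@summand_inj _ (fun=> B) i); rewrite t0 raddf0.
Qed.

Lemma infinite_range_copies_torsionfree k B :
    (forall (x : B) m, x *+ m.+1 = 0 -> x = 0) ->
  nonvanishing (copies k B) E t -> infinite_range (copies k B) E t.
Proof.
move=> tfB /nonvanishing_direct_sum[i nvB].
by apply: (infinite_range_summand (i := i)); apply: infinite_range_torsionfree.
Qed.

Lemma infinite_range_copies_omega k B :
  k = Omega -> nonvanishing B E t -> infinite_range (copies k B) E t.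
Proof.
move=> -> nvB; apply: (infinite_range_direct_sum (B := fun _ : nat => B)).
by apply: unbounded_nat => m; exists m.
Qed.

End NonVanishingCopies.
End Copies.

(** * Torsion in Szmielew groups: necessity of condition (2) *)

Lemma rat_torsionfree (x : rat) m : x *+ m.+1 = 0 -> x = 0.
Proof. by move/eqP; rewrite mulrn_eq0 => /eqP. Qed.

Lemma Z_loc_torsionfree p (x : Z_loc p) m : x *+ m.+1 = 0 -> x = 0.
Proof.
move=> /(congr1 val); rewrite raddfMn => /rat_torsionfree x0.
by apply: val_inj; rewrite x0.
Qed.

Lemma pair_mulrn (A B : zmodType) (x : A) (y : B) k : (x, y) *+ k = (x *+ k, y *+ k).
Proof. by elim: k => [|k IHk] //; rewrite !mulrS IHk. Qed.

Lemma direct_sum_mulrn0 (I : Type) (B : I -> zmodType) (x : direct_sum B) k :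
  x *+ k = 0 <-> forall i, coordinate i x *+ k = 0.
Proof.
split=> [x0 i|x0]; first by rewrite -raddfMn x0 raddf0.
by apply: coordinate_inj => i; rewrite raddfMn raddf0 -[RHS](x0 i).
Qed.

Lemma has_order_coprime (B : zmodType) (g : B) N M (z : int) :
  has_order g N -> coprime N M -> g *~ z *+ M = 0 -> g *~ z = 0.
Proof.
move=> ordg cop; rewrite pmulrn -mulrzA => /ordg zM; apply/ordg.
by rewrite Gauss_dvdzl in zM.
Qed.

Lemma prime_power_gt1 (p : prime_number) m : (1 < val p ^ m.+1)%N.
Proof. by rewrite -(exp1n m.+1) ltn_exp2r // prime_gt1 // (valP p). Qed.

Section SzmielewGroups.
Variables (kappa : prime_number -> nat -> cardinal_le_omega).
Variables (lambda mu : prime_number -> cardinal_le_omega) (nu : cardinal_le_omega).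
Local Notation A := (szmielew_group kappa lambda mu nu).
Local Notation component := (szmielew_component kappa lambda mu).

Definition cyclic_part p m (z : A) : copies (kappa p m) 'Z_(val p ^ m.+1) :=
  coordinate m (coordinate p z.1).1.1.

Definition pruefer_part p (z : A) : copies (lambda p) (pruefer p) :=
  (coordinate p z.1).1.2.

Fact cyclic_part_is_zmod_morphism p m : zmod_morphism (cyclic_part p m).
Proof.
move=> x y; rewrite /cyclic_part.
have -> : coordinate p (x - y).1 = coordinate p x.1 - coordinate p y.1 by exact: raddfB.
exact: raddfB.
Qed.

HB.instance Definition _ p m := GRing.isZmodMorphism.Build A
  (copies (kappa p m) 'Z_(val p ^ m.+1)) (cyclic_part p m)
  (cyclic_part_is_zmod_morphism p m).

Fact pruefer_part_is_zmod_morphism p : zmod_morphism (pruefer_part p).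
Proof.
move=> x y; rewrite /pruefer_part.
by have -> : coordinate p (x - y).1 = coordinate p x.1 - coordinate p y.1 by exact: raddfB.
Qed.

HB.instance Definition _ p := GRing.isZmodMorphism.Build A
  (copies (lambda p) (pruefer p)) (pruefer_part p) (pruefer_part_is_zmod_morphism p).

Definition of_cyclic p m (u : copies (kappa p m) 'Z_(val p ^ m.+1)) : A :=
  (summand (B := component) (i := p)
    (summand (B := fun m => copies (kappa p m) 'Z_(val p ^ m.+1)) u, 0, 0), 0).

Definition of_pruefer p (u : copies (lambda p) (pruefer p)) : A :=
  (summand (B := component) (i := p) (0, u, 0), 0).

Lemma of_cyclic_mulrn p m u k : @of_cyclic p m u *+ k = of_cyclic (u *+ k).
Proof.
rewrite /of_cyclic pair_mulrn -raddfMn !pair_mulrn !mul0rn.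
by rewrite -raddfMn.
Qed.

Lemma of_pruefer_mulrn p u k : @of_pruefer p u *+ k = of_pruefer (u *+ k).
Proof. by rewrite /of_pruefer pair_mulrn -raddfMn !pair_mulrn !mul0rn. Qed.

Lemma of_cyclic0 p m : of_cyclic (0 : copies (kappa p m) 'Z_(val p ^ m.+1)) = 0.
Proof. by rewrite -(mulr0n 0) -of_cyclic_mulrn mulr0n. Qed.

Lemma of_pruefer0 p : of_pruefer (0 : copies (lambda p) (pruefer p)) = 0.
Proof. by rewrite -(mulr0n 0) -of_pruefer_mulrn mulr0n. Qed.

Lemma cyclic_part_of p m u : cyclic_part p m (of_cyclic u) = u.
Proof. by rewrite /cyclic_part /of_cyclic !coordinate_summand. Qed.

Lemma pruefer_part_of p u : pruefer_part p (of_pruefer u) = u.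
Proof. by rewrite /pruefer_part /of_pruefer coordinate_summand. Qed.

(** Cyclic and Pruefer coordinates at q have order a power of q, hence prime to M, and Z_(q) is
    torsion-free. *)
Lemma szmielew_torsion_coprime (q : prime_number) M (x : component q) :
  (0 < M)%N -> coprime (val q) M -> x *+ M = 0 -> x = 0.
Proof.
case: x => [[x y] w] M_gt0 copM; rewrite !pair_mulrn => -[x0 y0 w0].
congr (_, _, _); apply: coordinate_inj => i; rewrite raddf0 /=.
- apply: coordinate_inj => j; rewrite raddf0 /=.
  move/direct_sum_mulrn0/(_ i)/direct_sum_mulrn0/(_ j): x0.
  rewrite [coordinate j _]Zp_generated.
  apply: (has_order_coprime (Zp_generator_order (prime_power_gt1 q i))).
  exact: coprimeXl.
- move/direct_sum_mulrn0/(_ i): y0; have [m /(_ 0)[z ->]] := pruefer_generated (coordinate i y).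
  apply: (has_order_coprime (@pruefer_generator_order q _)).
  exact: coprimeXl.
- move/direct_sum_mulrn0/(_ i): w0; rewrite -(prednK M_gt0).
  exact: Z_loc_torsionfree.
Qed.

(** Other primes and torsion-free summands have no p-torsion, and Z(p^(m+1)) with m < L is killed by
    p^L. There remain Z(p^(L+1)) and Z(p^oo), where z is assumed to be zero. *)
Lemma szmielew_ppower_torsion (p : prime_number) L (z : A) :
    (forall m, (L < m)%N -> kappa p m = Fin 0) ->
    (forall i, coordinate i (cyclic_part p L z) = 0) ->
    (forall i, coordinate i (pruefer_part p z) = 0) ->
  z *+ (val p ^ L.+1) = 0 -> z *+ (val p ^ L) = 0.
Proof.
have pexp_gt0 m : (0 < val p ^ m)%N by rewrite expn_gt0 prime_gt0 // (valP p).
rewrite /cyclic_part /pruefer_part; case: z => z r /= kappa0 cyc0 pru0; rewrite !pair_mulrn => -[z0 r0].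
congr pair; last first.
  apply/direct_sum_mulrn0 => i; move/direct_sum_mulrn0/(_ i): r0.
  by rewrite -(prednK (pexp_gt0 L.+1)) => /rat_torsionfree ->; rewrite mul0rn.
apply/direct_sum_mulrn0 => q; move/direct_sum_mulrn0/(_ q): z0.
have [qp|neq_qp] := eqVneq q p; last first.
  move/szmielew_torsion_coprime => -> //; first by rewrite mul0rn.
  by rewrite coprimeXr // prime_coprime ?(valP q) // dvdn_prime2 ?(valP p) ?(valP q).
rewrite {q}qp; move: (coordinate p z) cyc0 pru0 => [[x y] w] /= cyc0 pru0.
rewrite !pair_mulrn => -[x0 _ w0]; congr (_, _, _).
- apply/direct_sum_mulrn0 => m; apply/direct_sum_mulrn0 => i.
  case: (ltngtP m L) => [lt_mL|lt_Lm|eq_mL].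
  + by rewrite -(subnKC lt_mL) expnD mulrnA [X in X *+ _](Zp_mulrn_id (prime_power_gt1 p m)) mul0rn.
  + by case: (index_of_neq0 i (kappa0 _ lt_Lm)).
  + by move: i; rewrite eq_mL => i; rewrite cyc0 mul0rn.
- by apply/direct_sum_mulrn0 => i; rewrite pru0 mul0rn.
- apply/direct_sum_mulrn0 => i; move/direct_sum_mulrn0/(_ i): w0.
  by rewrite -(prednK (pexp_gt0 L.+1)) => /Z_loc_torsionfree ->; rewrite mul0rn.
Qed.

Lemma pruefer_finite_code (p : prime_number) m :
  exists (C : finType) (c : pruefer p -> C), forall x y,
    x *+ (val p ^ m) = 0 -> y *+ (val p ^ m) = 0 -> c x = c y -> x = y.
Proof.
exists (option 'I_(val p ^ m)),
  (fun x => [pick k : 'I_(val p ^ m) | x == pruefer_generator p m *+ k]) => x y.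
move=> /pruefer_torsion[i lt_i ->] /pruefer_torsion[j lt_j ->].
case: pickP => [k /eqP ->|/(_ (Ordinal lt_i))]; last by rewrite eqxx.
case: pickP => [k' /eqP ->|/(_ (Ordinal lt_j))]; last by rewrite eqxx.
by move=> [->].
Qed.

(** [square_like_torsion] is applied with a = p^(L+1) and b = p^L. Finitely many copies of
    Z(p^(L+1)) and Z(p^oo) make the image finite, hence trivial, while a single copy would make it
    non-trivial. *)
Lemma square_like_szmielew (p : prime_number) L k k' :
    square_like (Algebra.to_multiplicative A) ->
    kappa p L = Fin k -> lambda p = Fin k' ->
    (forall m, (L < m)%N -> kappa p m = Fin 0) ->
  kappa p L = Fin 0 /\ lambda p = Fin 0.
Proof.
move=> sqA kappa_fin lambda_fin kappa0.
have [T1 [f1 f1P]] := copies_finite_code (B := 'Z_(val p ^ L.+1)) id kappa_fin.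
have [C [c cP]] := pruefer_finite_code p L.+1.
have [T2 [f2 f2P]] := copies_finite_code c lambda_fin.
(* By [szmielew_ppower_torsion] applied to a difference, these codes determine p^L z for z killed by
   p^(L+1). *)
pose f (z : A) := (f1 (cyclic_part p L z), f2 (pruefer_part p z)).
have torA : forall z : A, z *+ (val p ^ L.+1) = 0 -> z *+ (val p ^ L) = 0.
  apply: (square_like_torsion (f := f) sqA) => x y x0 y0 [/f1P f1xy /f2P f2xy].
  apply/eqP; rewrite -subr_eq0 -mulrnBl; apply/eqP.
  apply: szmielew_ppower_torsion => // [i|i|]; last by rewrite mulrnBl x0 y0 subrr.
    by rewrite !raddfB /= f1xy subrr.
  rewrite !raddfB; apply/eqP; rewrite subr_eq0; apply/eqP/cP => //=.
    by move/(congr1 (pruefer_part p)): x0; rewrite raddfMn raddf0 => /direct_sum_mulrn0.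
  by move/(congr1 (pruefer_part p)): y0; rewrite raddfMn raddf0 => /direct_sum_mulrn0.
have ndvd : ~ (val p ^ L.+1 %| val p ^ L)%N.
  by rewrite dvdn_Pexp2l ?ltnn // prime_gt1 // (valP p).
(* A copy would contain an element of order exactly p^(L+1): 1 in the cyclic case, the class of
   1/p^(L+1) in the Pruefer case. *)
split; apply: contrapT => /index_of_inhabited[i].
  have order1 m := has_order_mulrn m (Zp_generator_order (prime_power_gt1 p L)).
  have := torA (of_cyclic (copy i (1 : 'Z_(val p ^ L.+1)))).
  rewrite !of_cyclic_mulrn !copy_mulrn Zp_mulrn_id ?prime_power_gt1 // copy0.
  move=> /(_ (of_cyclic0 _ _))/(congr1 (coordinate i \o cyclic_part p L)) /=.
  by rewrite cyclic_part_of coordinate_copy !raddf0 => /order1.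
have orderp m := has_order_mulrn m (@pruefer_generator_order p L.+1).
have := torA (of_pruefer (copy i (pruefer_generator p L.+1))).
rewrite !of_pruefer_mulrn !copy_mulrn.
have -> : pruefer_generator p L.+1 *+ (val p ^ L.+1) = 0.
  exact/orderp.
rewrite copy0 => /(_ (of_pruefer0 _))/(congr1 (coordinate i \o pruefer_part p)) /=.
by rewrite pruefer_part_of coordinate_copy !raddf0 => /orderp.
Qed.

End SzmielewGroups.

(** * Infinite ranges in Szmielew groups: sufficiency of condition (2) *)

Lemma finite_set_nat_bound (X : set nat) :
  finite_set X -> exists b, forall m, X m -> (m <= b)%N.
Proof.
move=> /finite_seqP[s ->]; exists (\max_(i <- s) i) => m ms.
exact: (leq_bigmax_seq (F := fun i => i)).
Qed.

Lemma infinite_range_szmielew (kappa : prime_number -> nat -> cardinal_le_omega)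
    (lambda mu : prime_number -> cardinal_le_omega) (nu : cardinal_le_omega) :
    (forall p : prime_number,
      let I_p := cyclic_exponents kappa p in
      [\/ lambda p = Omega,
          lambda p = Fin 0 /\
          (finite_set I_p -> I_p !=set0 ->
           forall l : nat, I_p l -> (forall n, I_p n -> (n <= l)%N) ->
             kappa p l.-1 = Omega)
        | (exists2 k : nat, (0 < k)%N & lambda p = Fin k) /\
          infinite_set I_p]) ->
  forall n (E : seq {ffun 'I_n -> int}) t,
    nonvanishing (szmielew_group kappa lambda mu nu) E t ->
    infinite_range (szmielew_group kappa lambda mu nu) E t.
Proof.
move=> cond n E t /nonvanishing_pair[/nonvanishing_direct_sum[p nvp]|nvQ]; last first.
  apply: infinite_range_pairr.
  by apply: infinite_range_copies_torsionfree nvQ; apply: rat_torsionfree.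
apply: infinite_range_pairl; apply: (infinite_range_summand (i := p)).
have pexp_gt0 m : (0 < val p ^ m)%N by rewrite expn_gt0 prime_gt0 // (valP p).
case/nonvanishing_pair: nvp => [nvp|nvZ]; last first.
  apply: infinite_range_pairr.
  by apply: infinite_range_copies_torsionfree nvZ; apply: Z_loc_torsionfree.
apply: infinite_range_pairl.
(* Some Z(p^(m+1)) contributes; in the absence of Pruefer summands it is one that occurs in the
   group. *)
have [m nvm kappa_m] : exists2 m, nonvanishing_mod E t (val p ^ m.+1) &
    lambda p = Fin 0 -> kappa p m <> Fin 0.
  case/nonvanishing_pair: nvp => [/nonvanishing_direct_sum[m]|].
    case/nonvanishing_copies=> kappa_m [v Ev tv]; exists m => //.
    have vE : v = (fun i => 1 *~ (v i : nat)).
      by apply: functional_extensionality_dep => i; apply: Zp_generated.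
    rewrite vE in Ev tv.
    exact: nonvanishing_mod_of (Zp_generator_order (prime_power_gt1 p m)) Ev tv.
  case/nonvanishing_copies=> lambda_p [v Ev tv].
  have [m /choice[a va]] := pruefer_tuple_generated v.
  have vE : v = (fun i => pruefer_generator p m *~ a i).
    by apply: functional_extensionality_dep.
  rewrite vE in Ev tv; exists m => //.
  apply: nonvanishing_mod_dvd (pexp_gt0 _) (dvdn_exp2l _ (leqnSn m)) _.
  exact: nonvanishing_mod_of (@pruefer_generator_order p m) Ev tv.
have nv_cyclic m' : (m <= m')%N -> kappa p m' <> Fin 0 ->
    nonvanishing (copies (kappa p m') 'Z_(val p ^ m'.+1)) E t.
  move=> le_mm' kappa_m'; apply/nonvanishing_copies; split=> //.
  apply: (nonvanishing_of_mod (Zp_generator_order (prime_power_gt1 p m'))).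
  by apply: nonvanishing_mod_dvd nvm => //; apply: dvdn_exp2l.
have infinite_case : infinite_set (cyclic_exponents kappa p) -> infinite_range
    (direct_sum (fun m : nat => copies (kappa p m) 'Z_(val p ^ m.+1)) *
     copies (lambda p) (pruefer p))%type E t.
  move=> infI; apply: infinite_range_pairl; apply: infinite_range_direct_sum.
  (* If all contributing indices were below b, every exponent in I_p would be at most the maximum of
     b and m. *)
  apply: unbounded_nat => b; apply: contrapT => bounded; apply: infI.
  apply: (sub_finite_set _ (finite_II (maxn b m).+1)) => i [i_gt0 kappa_i].
  rewrite /= ltnNge; apply/negP => lt_i; apply: bounded.
  have le_i : (maxn b m <= i.-1)%N by rewrite -ltnS prednK.
  exists i.-1; last exact: leq_trans (leq_maxl _ _) le_i.
  by apply: nv_cyclic => //; apply: leq_trans (leq_maxr _ _) le_i.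
case: (cond p) => [lambda_p|[lambda_p max_omega]|[_ infI]]; last exact: infinite_case.
  apply/infinite_range_pairr/(infinite_range_copies_omega lambda_p).
  exact: nonvanishing_of_mod (@pruefer_generator_order p m.+1) nvm.
have [finI|] := pselect (finite_set (cyclic_exponents kappa p)); last exact: infinite_case.
(* The exponent m+1 lies in I_p, so the maximum l of I_p is at least m+1; thus Z(p^l) contributes,
   and it occurs infinitely often. *)
have Im : cyclic_exponents kappa p m.+1 by split; last exact: kappa_m.
have [b Ib] := finite_set_nat_bound finI.
have exI : exists l, `[< cyclic_exponents kappa p l >] by exists m.+1; apply/asboolP.
have [|l /asboolP Il l_max] := @ex_maxnP (fun l => `[< cyclic_exponents kappa p l >]) b exI.
  by move=> l /asboolP/Ib.
have kappa_l : kappa p l.-1 = Omega.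
  apply: max_omega => //; first by exists m.+1.
  by move=> l' Il'; apply: l_max; apply/asboolP.
have le_ml : (m <= l.-1)%N.
  by case: Il => l_gt0 _; rewrite -ltnS prednK //; apply: l_max; apply/asboolP.
apply: infinite_range_pairl; apply: (infinite_range_summand (i := l.-1)).
have kappa_l0 : kappa p l.-1 <> Fin 0 by rewrite kappa_l.
apply: infinite_range_copies_omega kappa_l _.
by case/nonvanishing_copies: (nv_cyclic _ le_ml kappa_l0).
Qed.

Theorem proposition2p2
    (kappa : prime_number -> nat -> cardinal_le_omega)
    (lambda mu : prime_number -> cardinal_le_omega)
    (nu : cardinal_le_omega) :
  square_like (Algebra.to_multiplicative (szmielew_group kappa lambda mu nu)) <->
  (forall p : prime_number,
    let I_p := cyclic_exponents kappa p in
    [\/ lambda p = Omega,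
        lambda p = Fin 0 /\
        (finite_set I_p -> I_p !=set0 ->
         forall l : nat, I_p l -> (forall n, I_p n -> (n <= l)%N) ->
           kappa p l.-1 = Omega)
      | (exists2 k : nat, (0 < k)%N & lambda p = Fin k) /\
        infinite_set I_p]).
Proof.
split=> [sqA p|cond]; last first.
  by apply: square_like_of_infinite_range; apply: infinite_range_szmielew.
(* As [kappa p m] counts Z(p^(m+1)), a bound L on the exponents already excludes the index m = L. *)
have kappa_bound L : (forall l, cyclic_exponents kappa p l -> (l <= L)%N) ->
    forall m, (L <= m)%N -> kappa p m = Fin 0.
  move=> IL m le_Lm; apply: contrapT => kappa_m.
  by have := IL m.+1 (conj isT kappa_m); rewrite ltnNge le_Lm.
case lambda_p: (lambda p) => [[|k]|]; [apply: Or32|apply: Or33|exact: Or31].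
  split=> // _ _ l [l_gt0 kappa_l] l_max.
  case kappa_l1: (kappa p l.-1) => [k|] //; case: kappa_l.
  (* With L = l - 1, the index of the largest exponent, a finite multiplicity would be zero, against
     l being in I_p. *)
  apply: (proj1 (square_like_szmielew sqA kappa_l1 lambda_p _)) => m lt_lm.
  by apply: kappa_bound l_max _ _; rewrite -(prednK l_gt0).
split; first by exists k.+1.
(* A bound b on I_p would allow L = b, where the cyclic multiplicity is zero, and would force
   [lambda p] to be zero. *)
move=> /finite_set_nat_bound[b /kappa_bound kappa0].
have [|_] := square_like_szmielew sqA (kappa0 b (leqnn b)) lambda_p.
  by move=> m /ltnW; apply: kappa0.
by rewrite lambda_p.
Qed.
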